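(* Let $1\le r\le d$, let $I=\{i_1<\dots<i_r\}\subset[d]$, let $X$ be a $d\times d$ Hermitian matrix and let $M\in GL(d,\mathbb{C})$. Then $$\lambda_q^\uparrow(X_{M^{-1}L})\le\lambda_{i_q}^\uparrow(X)\qquad\text{for all }L\in\Omega_I(MF_\bullet^\uparrow(X))\text{ and all }q\in[r],$$ $$\lambda_q^\uparrow(X_{M^{-1}L})\ge\lambda_{i_q}^\uparrow(X)\qquad\text{for all }L\in\Omega_{I^\vee}(MF_\bullet^\downarrow(X))\text{ and all }q\in[r].$$ Consequently, for a function $\varphi:\mathbb{R}^r\to\mathbb{R}$: (1) If $\varphi$ is coordinatewise nondecreasing, then $$\varphi(\lambda_{i_1}^\uparrow(X),\dots,\lambda_{i_r}^\uparrow(X))=\max_{L\in\Omega_I(MF_\bullet^\uparrow(X))}\Theta_{X,\varphi}(M^{-1}L)=\min_{L\in\Omega_{I^\vee}(MF_\bullet^\downarrow(X))}\Theta_{X,\varphi}(M^{-1}L).$$ (2) If $\varphi$ is coordinatewise nonincreasing, then $$\varphi(\lambda_{i_1}^\uparrow(X),\dots,\lambda_{i_r}^\uparrow(X))=\min_{L\in\Omega_I(MF_\bullet^\uparrow(X))}\Theta_{X,\varphi}(M^{-1}L)=\max_{L\in\Omega_{I^\vee}(MF_\bullet^\downarrow(X))}\Theta_{X,\varphi}(M^{-1}L).$$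
   Context: $[d]=\{1,\dots,d\}$; $\mathrm{Gr}(r,d)$ is the set of $r$-dimensional subspaces of $\mathbb{C}^d$. For a Hermitian matrix $A$, $\lambda_1^\uparrow(A)\le\lambda_2^\uparrow(A)\le\cdots$ are its eigenvalues in increasing order with multiplicity. For $I=\{i_1<\dots<i_r\}\subset[d]$, the dual subset is $I^\vee=\{d+1-i_r<\dots<d+1-i_1\}$. For a complete flag $E_\bullet=(E_1\subset\cdots\subset E_d=\mathbb{C}^d)$, $\dim E_k=k$, the Schubert variety is $$\Omega_I(E_\bullet)=\{L\in\mathrm{Gr}(r,d):\dim(L\cap E_{i_q})\ge q\text{ for }q=1,\dots,r\}.$$ For $M\in GL(d,\mathbb{C})$, $ME_\bullet$ is the flag with members $ME_k$. For Hermitian $X$, $F_\bullet^\uparrow(X)$ (resp. $F_\bullet^\downarrow(X)$) denotes an increasing (resp. decreasing) eigenflag: the complete flag whose $k$-th member is spanned by the first $k$ vectors of an orthonormal eigenbasis of $X$ ordered so that the eigenvalues are in increasing (resp. decreasing) order. For $L\in\mathrm{Gr}(r,d)$, let $V_L:\mathbb{C}^r\to\mathbb{C}^d$ be an isometry with image $L$ and put $X_L=V_L^\dagger XV_L$ (its eigenvalues do not depend on the choice of $V_L$). A function $\varphi:\mathbb{R}^r\to\mathbb{R}$ is coordinatewise nondecreasing (resp. nonincreasing) if $x_i\le y_i$ for all $i$ implies $\varphi(x)\le\varphi(y)$ (resp. $\varphi(x)\ge\varphi(y)$). Define $\Theta_{X,\varphi}(L)=\varphi(\lambda_1^\uparrow(X_L),\dots,\lambda_r^\uparrow(X_L))$.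 *)

(* Defs.v *)
From HB Require Import structures.
From mathcomp Require Import all_boot all_order all_algebra.
From mathcomp Require Import sesquilinear spectral.
From mathcomp Require Import complex.
From mathcomp Require Import classical_sets reals.

Set Implicit Arguments.
Unset Strict Implicit.
Unset Printing Implicit Defensive.

Import Order.TTheory GRing.Theory Num.Theory.
Local Open Scope ring_scope.
Local Open Scope sesquilinear_scope.
Local Open Scope complex_scope.

(* All indices are 0-based: an element k of [d] is the ordinal k - 1 : 'I_d. *)

Section Subsets.
Variables (r d : nat).

Record ksubset := KSubset { kset :> {set 'I_d}; card_kset : #|kset| = r }.

(* [elt I q] is i_(q+1) when I = {i_1 < ... < i_r}: enumerations of sets of
   ordinals are increasing, see [elt_lt]. *)
Definition elt (I : ksubset) (q : 'I_r) : 'I_d :=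
  enum_val (cast_ord (esym (card_kset I)) q).

Lemma elt_lt (I : ksubset) (p q : 'I_r) : (p < q)%N -> (elt I p < elt I q)%N.
Proof.
move=> lt_pq; rewrite /elt.
have sorted_I : sorted ltn (map val (enum I)).
  rewrite {1}/enum_mem -enumT.
  apply: (subseq_sorted ltn_trans (map_subseq _ (filter_subseq _ _))).
  by rewrite val_enum_ord iota_ltn_sorted.
have sz : size (enum I) = r by rewrite -cardE card_kset.
rewrite /enum_val !(set_nth_default (elt I p) (enum_default _)) ?sz //=.
rewrite -!(nth_map (elt I p) 0%N val) ?sz //.
by apply: (sorted_ltn_nth ltn_trans) => //; rewrite inE size_map sz.
Qed.

Lemma card_dual (I : ksubset) : #|[set rev_ord i | i in I]| = r.
Proof. by rewrite card_imset ?card_kset //; exact: rev_ord_inj. Qed.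

(* [rev_ord] is i |-> d + 1 - i in 1-based indexing. *)
Definition dual (I : ksubset) : ksubset := KSubset (card_dual I).

End Subsets.

Section Eigenvalues.
Variable R : realType.
Local Notation C := R[i].

(* Eigenvalues with multiplicity, in increasing order, as a vector of R^n; the
   real parts are only taken to land in R, see [char_poly_eigs]. *)
Definition eigs n (A : 'M[C]_n) : 'rV[R]_n :=
  \row_k (sort <=%R [seq complex.Re z |
            z <- sval (closed_field_poly_normal (char_poly A))])`_k.

Lemma char_poly_conj n (P Q A : 'M[C]_n) :
  P *m Q = 1%:M -> char_poly (P *m A *m Q) = char_poly A.
Proof.
move=> PQ; rewrite /char_poly.
have -> : char_poly_mx (P *m A *m Q) =
    map_mx polyC P *m char_poly_mx A *m map_mx polyC Q.
  rewrite /char_poly_mx mulmxBr mulmxBl !map_mxM; congr (_ - _).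
  by rewrite scalar_mxC -mulmxA -map_mxM PQ map_mx1 mulmx1.
rewrite !det_mulmx mulrAC -det_mulmx -map_mxM PQ map_mx1 det1.
by rewrite mul1r.
Qed.

Lemma size_charroots n (A : 'M[C]_n) :
  size (sval (closed_field_poly_normal (char_poly A))) = n.
Proof.
case: closed_field_poly_normal => s /= /(congr1 (fun p : {poly C} => size p)).
rewrite (monicP (char_poly_monic A)) scale1r size_char_poly.
by rewrite size_prod_XsubC => -[].
Qed.

Lemma charroots_real n (A : 'M[C]_n) : A \is hermsymmx ->
  forall z, root (char_poly A) z -> z = (complex.Re z)%:C.
Proof.
move=> hA z; have /orthomx_spectralP A_eq := hermitian_normalmx hA.
have /mxOverP D_real := hermitian_spectral_diag_real hA.
rewrite A_eq char_poly_conj ?mulVmx ?spectral_unit // char_poly_trig; last first.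
  exact: diag_mx_is_trig.
rewrite /root horner_prod prodf_seq_eq0 => /hasP[k _].
rewrite /= !hornerE !mxE eqxx mulr1n subr_eq0 => /eqP ->.
have := D_real 0 k; rewrite realE !lecE /=.
case: (spectral_diag A 0 k) => a b /= /orP[]/andP[/eqP e _].
  by rewrite e.
by rewrite -e.
Qed.

Lemma char_poly_eigs n (A : 'M[C]_n) : A \is hermsymmx ->
  char_poly A = \prod_(k < n) ('X - ((eigs A 0 k)%:C)%:P).
Proof.
move=> hA; have := size_charroots A; have := charroots_real hA.
rewrite /eigs; case: closed_field_poly_normal => s /=.
rewrite (monicP (char_poly_monic A)) scale1r => -> s_real sz.
have -> : \prod_(z <- s) ('X - z%:P) =
    \prod_(x <- [seq complex.Re z | z <- s]) ('X - (x%:C)%:P).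
  rewrite big_map; apply: eq_big_seq => z zs; congr ('X - _%:P).
  by apply: s_real; rewrite root_prod_XsubC.
rewrite -(perm_big _ (permEl (perm_sort <=%R _))) /=.
rewrite (big_nth 0) size_sort size_map sz big_mkord.
by apply: eq_bigr => k _; rewrite mxE.
Qed.

Lemma eigs_le n (A : 'M[C]_n) (j k : 'I_n) :
  (j <= k)%N -> eigs A 0 j <= eigs A 0 k.
Proof.
move=> le_jk; rewrite !mxE.
apply: (sorted_leq_nth le_trans le_refl) => //.
- by apply: sort_sorted; exact: le_total.
- by rewrite inE size_sort size_map size_charroots.
- by rewrite inE size_sort size_map size_charroots.
Qed.

End Eigenvalues.

Section Subspaces.
Variable R : realType.
Local Notation C := R[i].

Record grass (r d : nat) :=
  Grass { gr_space :> {vspace 'cV[C]_d}; dim_gr : \dim gr_space = r }.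

(* The members E_1, ..., E_d are [E ord0], ..., [E ord_max]. *)
Record flag (d : nat) := Flag {
  flag_at :> 'I_d -> {vspace 'cV[C]_d};
  dim_flag : forall k, \dim (flag_at k) = k.+1;
  flag_sub : forall j k : 'I_d, (j <= k)%N -> (flag_at j <= flag_at k)%VS }.

Record gl (d : nat) := GL { gl_mx :> 'M[C]_d; gl_unit : gl_mx \in unitmx }.

Definition gl_inv d (M : gl d) : gl d :=
  GL (etrans (unitmx_inv M) (gl_unit M)).

Definition mximg m n (M : 'M[C]_(m, n)) (U : {vspace 'cV[C]_n}) :
  {vspace 'cV[C]_m} := (linfun (mulmx M) @: U)%VS.

Lemma lker_mulmx m n (M : 'M[C]_(m, n)) (N : 'M[C]_(n, m)) :
  N *m M = 1%:M -> lker (linfun (mulmx M : 'cV[C]_n -> 'cV[C]_m)) == 0%VS.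
Proof.
move=> NM; apply/lker0P => x y; rewrite !lfunE /= => /(congr1 (mulmx N)).
by rewrite !mulmxA NM !mul1mx.
Qed.

Lemma dim_mximg m n (M : 'M[C]_(m, n)) (N : 'M[C]_(n, m)) U :
  N *m M = 1%:M -> \dim (mximg M U) = \dim U.
Proof. by move=> /lker_mulmx/eqP ker0; rewrite limg_dim_eq // ker0 capv0. Qed.

Lemma dim_gl d (M : gl d) U : \dim (mximg M U) = \dim U.
Proof. exact: dim_mximg (mulVmx (gl_unit M)). Qed.

Definition gr_act r d (M : gl d) (L : grass r d) : grass r d :=
  Grass (etrans (dim_gl M L) (dim_gr L)).

Definition flag_act d (M : gl d) (E : flag d) : flag d :=
  @Flag d (fun k => mximg M (E k))
    (fun k => etrans (dim_gl M (E k)) (dim_flag E k))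
    (fun j k le_jk => limgS _ (flag_sub E le_jk)).

(* [elt I q] is also the 0-based index of the member of dimension i_(q+1). *)
Definition schubert r d (I : ksubset r d) (E : flag d) : set (grass r d) :=
  [set L | forall q : 'I_r, (q.+1 <= \dim (L :&: E (elt I q)))%N].

(* The columns of [U] form an orthonormal eigenbasis with eigenvalues [l]. *)
Definition eigenflag d (X : 'M[C]_d) (l : 'I_d -> R) (F : flag d) :=
  exists2 U : 'M[C]_d, U \is unitarymx &
    (forall k, X *m col k U = (l k)%:C *: col k U) /\
    (forall k, F k = <<[seq col j U | j : 'I_d <- enum 'I_d & (j <= k)%N]>>%VS).

Definition increasing_eigenflag d (X : 'M[C]_d) (F : flag d) :=
  exists2 l : 'I_d -> R, (forall j k : 'I_d, (j <= k)%N -> l j <= l k) &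
    eigenflag X l F.

Definition decreasing_eigenflag d (X : 'M[C]_d) (F : flag d) :=
  exists2 l : 'I_d -> R, (forall j k : 'I_d, (j <= k)%N -> l k <= l j) &
    eigenflag X l F.

Definition isometry_onto r d (L : grass r d) (V : 'M[C]_(d, r)) : bool :=
  (V^t* *m V == 1%:M) && (mximg V fullv == L).

Lemma isometry_exists r d (L : grass r d) : exists V, isometry_onto L V.
Proof.
have szb : size (vbasis L) == r by rewrite size_tuple dim_gr.
pose b : r.-tuple 'cV[C]_d := Tuple szb.
have b_basis : basis_of L b := vbasisP L.
pose A : 'M[C]_(r, d) := \matrix_(i < r) (tnth b i)^T.
have A_comb (x : 'rV[C]_r) : (x *m A)^T = \sum_i x 0 i *: tnth b i.
  rewrite mulmx_sum_row linear_sum /=; apply: eq_bigr => i _.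
  by rewrite linearZ /= rowK trmxK.
have freeA : row_free A.
  apply: inj_row_free => x /(congr1 trmx); rewrite trmx0 A_comb => x_b.
  apply/rowP => i; rewrite mxE; move/freeP: (basis_free b_basis).
  by apply; rewrite -[RHS]x_b; apply: eq_bigr => j _; rewrite (tnth_nth 0).
have le_rd : (r <= d)%N.
  by rewrite -(dim_gr L) (leq_trans (dimvS (subvf _))) ?dimvf ?/dim //= muln1.
have S_unitary := schmidt_unitarymx A le_rd.
have V_iso : (schmidt A)^T^t* *m (schmidt A)^T = 1%:M.
  have /unitarymxP S1 := S_unitary.
  by rewrite trmxK -[RHS]trmx1 -S1 trmx_mul map_trmx trmxK.
exists (schmidt A)^T; rewrite /isometry_onto V_iso eqxx /=.
rewrite eqEdim (dim_mximg _ V_iso) dimvf dim_gr /dim /= muln1 leqnn andbT.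
apply/subvP => _ /memv_imgP[x _ ->]; rewrite lfunE /=.
have /submxP[y y_A] : (x^T *m schmidt A <= A)%MS.
  by rewrite (submx_trans (submxMl _ _)) ?(eqmx_schmidt_free freeA).
rewrite -[x]trmxK -trmx_mul y_A A_comb; apply: memv_suml => i _.
by rewrite memvZ // vbasis_mem // -/(val b) mem_tnth.
Qed.

(* V_L; [eigs_compress] shows that the choice is irrelevant below. *)
Definition isom r d (L : grass r d) : 'M[C]_(d, r) :=
  xchoose (isometry_exists L).

Definition compress r d (X : 'M[C]_d) (L : grass r d) : 'M[C]_r :=
  (isom L)^t* *m X *m isom L.

Lemma eigs_compress r d (X : 'M[C]_d) (L : grass r d) (V : 'M[C]_(d, r)) :
  isometry_onto L V -> eigs (V^t* *m X *m V) = eigs (compress X L).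
Proof.
move=> /andP[/eqP V_iso /eqP V_L]; rewrite /compress.
have /andP[/eqP W_iso /eqP W_L] := xchooseP (isometry_exists L).
rewrite -/(isom L) in W_iso W_L; set W := isom L in W_iso W_L *.
have VW : W *m W^t* *m V = V.
  suff VWc k : col k (W *m W^t* *m V) = col k V.
    by apply/matrixP => i k; have /colP/(_ i) := VWc k; rewrite ![col _ _ _ _]mxE.
  have : col k V \in (L : {vspace _}).
    by rewrite -V_L colE -[V *m _](lfunE (mulmx V)) memv_img ?memvf.
  rewrite -W_L => /memv_imgP[x _]; rewrite lfunE /= => Vk.
  by rewrite colE -mulmxA -colE Vk -mulmxA (mulmxA (W^t*)) W_iso mul1mx.
pose P := V^t* *m W; pose Q := W^t* *m V.
have PQ : P *m Q = 1%:M by rewrite /P /Q -mulmxA (mulmxA W) VW.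
have VW' : V^t* *m W *m W^t* = V^t*.
  by rewrite -[in RHS]VW !trmx_mul !map_mxM /= trmxCK mulmxA.
have <- : P *m (W^t* *m X *m W) *m Q = V^t* *m X *m V.
  by rewrite /P /Q !mulmxA VW' -!mulmxA (mulmxA W) VW.
by rewrite /eigs (char_poly_conj _ PQ).
Qed.

Definition Theta r d (X : 'M[C]_d) (phi : 'rV[R]_r -> R) (L : grass r d) : R :=
  phi (eigs (compress X L)).

Definition coord_nondecreasing r (phi : 'rV[R]_r -> R) :=
  forall x y : 'rV[R]_r, (forall i, x 0 i <= y 0 i) -> phi x <= phi y.

Definition coord_nonincreasing r (phi : 'rV[R]_r -> R) :=
  forall x y : 'rV[R]_r, (forall i, x 0 i <= y 0 i) -> phi y <= phi x.

Definition is_max (A : set R) (m : R) := A m /\ ubound A m.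
Definition is_min (A : set R) (m : R) := A m /\ lbound A m.

End Subspaces.

(* Main.v *)
(* L lies in Omega_I(M F) iff M^-1 L lies in Omega_I(F), so M plays no role.
   On the member F_(i_q) of an increasing eigenflag the quadratic form of X is at
   most lambda_(i_q), and L meets it in dimension at least q, so Courant-Fischer
   bounds the q-th eigenvalue of the compression; the span of the eigenvectors
   indexed by I turns all these bounds into equalities.  The statements on
   decreasing eigenflags follow by replacing X with -X, which reverses the
   eigenvalues and exchanges I with its dual. *)

Require Import Defs.
From HB Require Import structures.
From mathcomp Require Import all_boot all_order all_algebra.
From mathcomp Require Import sesquilinear spectral.
From mathcomp Require Import complex.
From mathcomp Require Import classical_sets reals.
From mathcomp Require Import perm.

Set Implicit Arguments.
Unset Strict Implicit.
Unset Printing Implicit Defensive.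

Import Order.TTheory GRing.Theory Num.Theory.
Local Open Scope ring_scope.
Local Open Scope sesquilinear_scope.
Local Open Scope complex_scope.

(** * Dimension count for kernels *)

Section Dimension.
Variable K : fieldType.

(** Rank-nullity on [W]: its image under [B] has dimension at most [m]. *)
Lemma dim_cap_lker m n (B : 'M[K]_(m, n)) (W : {vspace 'cV[K]_n}) :
  (\dim W <= \dim (W :&: lker (linfun (mulmx B : 'cV_n -> 'cV_m))) + m)%N.
Proof.
rewrite -{1}(limg_ker_dim (linfun (mulmx B : 'cV_n -> 'cV_m)) W) leq_add2l.
by rewrite (leq_trans (dimvS (subvf _))) // dimvf /dim /= muln1.
Qed.

End Dimension.

(** * Ordered eigenvalues of Hermitian matrices *)

Section Hermitian.
Variable R : realType.
Local Notation C := R[i].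
Local Notation diagC l := (diag_mx (\row_k (l k)%:C)).

(** The linear factors are determined up to order, and a multiset has only one sorted listing. *)
Lemma eigs_char_poly n (A : 'M[C]_n) (l : 'I_n -> R) :
  (forall j k : 'I_n, (j <= k)%N -> l j <= l k) ->
  char_poly A = \prod_(k < n) ('X - ((l k)%:C)%:P) ->
  forall k, eigs A 0 k = l k.
Proof.
move=> l_le; rewrite /eigs => Al k; rewrite mxE.
case: closed_field_poly_normal => s /=.
rewrite (monicP (char_poly_monic A)) scale1r Al => s_prod.
have /(perm_map (@complex.Re R)) : perm_eq [seq (l k)%:C | k <- enum 'I_n] s.
  by apply: prod_XsubC_eq; rewrite -s_prod big_map big_enum.
rewrite -map_comp (@eq_map _ _ _ l) // => s_perm.
have -> : sort <=%R [seq complex.Re z | z <- s] = [seq l k | k <- enum 'I_n].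
  apply: (sorted_eq le_trans le_anti); first exact/sort_sorted/le_total.
    rewrite sorted_map; apply: (@sub_sorted _ (fun j k : 'I_n => (j <= k)%N)).
      by move=> i j; exact: l_le.
    by have := iota_sorted 0 n; rewrite -val_enum_ord sorted_map.
  by rewrite perm_sort perm_sym.
by rewrite (nth_map k) ?size_enum_ord // nth_ord_enum.
Qed.

Lemma char_poly_unitary_diag n (A U : 'M[C]_n) (l : 'I_n -> R) :
  U \is unitarymx -> A *m U = U *m diagC l ->
  char_poly A = \prod_(k < n) ('X - ((l k)%:C)%:P).
Proof.
move=> U1 AU; rewrite -(mulmxtVK A U1) AU char_poly_conj; last exact/unitarymxP.
rewrite char_poly_trig ?diag_mx_is_trig //.
by apply: eq_bigr => k _; rewrite !mxE eqxx mulr1n.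
Qed.

Lemma eigs_unitary_diag n (A U : 'M[C]_n) (l : 'I_n -> R) :
  (forall j k : 'I_n, (j <= k)%N -> l j <= l k) ->
  U \is unitarymx -> A *m U = U *m diagC l -> forall k, eigs A 0 k = l k.
Proof.
by move=> l_le U1 AU; apply: eigs_char_poly => //; exact: char_poly_unitary_diag AU.
Qed.

(** The spectral theorem lists the eigenvalues in an unspecified order. Both lists are the roots of
    the characteristic polynomial, so they differ by a permutation, which the unitary absorbs. *)
Lemma unitary_diag_eigs n (A : 'M[C]_n) : A \is hermsymmx ->
  exists2 U : 'M[C]_n, U \is unitarymx & A *m U = U *m diagC (eigs A 0).
Proof.
move=> hA; have /orthomx_spectralP := hermitian_normalmx hA.
have P1 := spectral_unitarymx A; move: (char_poly_eigs hA).
move: (eigs A 0) (spectralmx A) (spectral_diag A) P1 => l P sp P1 + A_eq.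
have /unitarymxP PP1 := P1.
rewrite invmx_unitary // in A_eq.
have PP2 : P^t* *m P = 1%:M by apply: mulmx1C.
rewrite A_eq char_poly_conj // char_poly_trig ?diag_mx_is_trig // => sp_l.
have /tuple_permP[s s_l] : perm_eq [seq (l k)%:C | k <- enum 'I_n]
    [tuple sp 0 k | k < n].
  apply: prod_XsubC_eq; rewrite big_map big_enum -sp_l /= big_map big_enum /=.
  by apply: eq_bigr => k _; rewrite !mxE eqxx mulr1n.
have l_sp k : (l k)%:C = sp 0 (s k).
  have := congr1 (fun t : seq C => nth 0 t k) s_l.
  rewrite (nth_map k) ?size_enum_ord // nth_ord_enum => ->.
  by rewrite (nth_map k) ?size_enum_ord // nth_ord_enum tnth_mktuple.
(* Column [k] is column [s k] of [P^t*], an eigenvector for [sp 0 (s k)], which is [l k]. *)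
exists (P^t* *m (perm_mx s)^T).
  apply: mul_unitarymx; first by rewrite trmxC_unitary.
  rewrite trmx_unitary.
  apply/unitarymxP; rewrite tr_perm_mx map_perm_mx -perm_mxM.
  by rewrite mulgV perm_mx1.
rewrite -!mulmxA; congr (_ *m _); rewrite (mulmxA P) PP1 mul1mx.
apply/matrixP => i j; rewrite mul_diag_mx mul_mx_diag !mxE.
rewrite l_sp mulrC; case: eqP => [->|]; first by [].
by rewrite !mul0r.
Qed.

Lemma eigs_opp n (A : 'M[C]_n) : A \is hermsymmx ->
  forall k, eigs (- A) 0 k = - eigs A 0 (rev_ord k).
Proof.
move=> /unitary_diag_eigs[U U1 AU].
apply: eigs_char_poly => [j k le_jk|].
  by rewrite lerN2 eigs_le //= leq_sub2l.
have /(char_poly_unitary_diag U1) -> :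
    - A *m U = U *m diagC (fun k => - eigs A 0 k).
  rewrite mulNmx AU -mulmxN; congr (_ *m _).
  by apply/matrixP => i j; rewrite !mxE rmorphN mulNrn.
(* The columns of [U] list the eigenvalues of [- A] in decreasing order; reversing the product sorts
   them. *)
by rewrite (reindex_inj rev_ord_inj).
Qed.

(** * Quadratic forms and the Courant-Fischer bound *)

Lemma hform_diag n (l : 'I_n -> R) (y : 'cV[C]_n) :
  (y^t* *m diagC l *m y) 0 0 = \sum_k (l k)%:C * `|y k 0| ^+ 2.
Proof.
rewrite mxE; apply: eq_bigr => k _.
by rewrite mul_mx_diag !mxE normCK mulrAC mulrC [_^* * _]mulrC.
Qed.

(** [U^t* *m x] holds the coordinates of [x] in the orthonormal eigenbasis formed by the columns of
    [U]. *)
Lemma hform_conj n (A U : 'M[C]_n) (l : 'I_n -> R) (x : 'cV[C]_n) :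
  U \is unitarymx -> A *m U = U *m diagC l ->
  (x^t* *m A *m x) 0 0 = \sum_k (l k)%:C * `|(U^t* *m x) k 0| ^+ 2.
Proof.
move=> U1 AU; rewrite -hform_diag trmx_mul map_mxM /= trmxCK.
by rewrite [in RHS]mulmxA -(mulmxA _ U) -AU !mulmxA mulmxtVK.
Qed.

(** Parseval's identity, as [hform_conj] for the identity matrix. *)
Lemma dotc_unitary n (U : 'M[C]_n) (x : 'cV[C]_n) : U \is unitarymx ->
  (x^t* *m x) 0 0 = \sum_k `|(U^t* *m x) k 0| ^+ 2.
Proof.
move=> U1; rewrite -[x^t*]mulmx1 (@hform_conj _ _ U (fun=> 1)) //.
  by apply: eq_bigr => k _; rewrite mul1r.
rewrite mul1mx -[LHS]mulmx1; congr (_ *m _).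
by apply/matrixP => i j; rewrite !mxE.
Qed.

Lemma hform_le n (A U : 'M[C]_n) (l : 'I_n -> R) (c : R) (x : 'cV[C]_n) :
  U \is unitarymx -> A *m U = U *m diagC l ->
  (forall k, (U^t* *m x) k 0 != 0 -> l k <= c) ->
  (x^t* *m A *m x) 0 0 <= c%:C * (x^t* *m x) 0 0.
Proof.
move=> U1 AU lc; rewrite (hform_conj _ U1 AU) (dotc_unitary _ U1) mulr_sumr.
apply: ler_sum => k _; have [->|nz] := eqVneq ((U^t* *m x) k 0) 0.
  by rewrite normr0 expr0n !mulr0.
by rewrite ler_wpM2r ?exprn_ge0 // lecR lc.
Qed.

Lemma hform_ge n (A U : 'M[C]_n) (l : 'I_n -> R) (c : R) (x : 'cV[C]_n) :
  U \is unitarymx -> A *m U = U *m diagC l ->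
  (forall k, (U^t* *m x) k 0 != 0 -> c <= l k) ->
  c%:C * (x^t* *m x) 0 0 <= (x^t* *m A *m x) 0 0.
Proof.
move=> U1 AU lc; rewrite (hform_conj _ U1 AU) (dotc_unitary _ U1) mulr_sumr.
apply: ler_sum => k _; have [->|nz] := eqVneq ((U^t* *m x) k 0) 0.
  by rewrite normr0 expr0n !mulr0.
by rewrite ler_wpM2r ?exprn_ge0 // lecR lc.
Qed.

Lemma dotc_gt0 n (x : 'cV[C]_n) : x != 0 -> 0 < (x^t* *m x) 0 0.
Proof.
have U1 : (1%:M : 'M[C]_n) \is unitarymx.
  by apply/unitarymxP; rewrite trmx1 map_mx1 mulmx1.
move=> x0; rewrite (dotc_unitary _ U1) trmx1 map_mx1 mul1mx.
rewrite lt_def sumr_ge0 ?andbT; last by move=> k _; rewrite exprn_ge0.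
apply: contraNneq x0 => /eqP; rewrite psumr_eq0; last first.
  by move=> k _; rewrite exprn_ge0.
move=> /allP xk; apply/eqP/colP => k; rewrite mxE.
by have := xk k; rewrite mem_index_enum sqrf_eq0 normr_eq0 => /(_ isT)/eqP.
Qed.

(* Courant-Fischer: W meets the span of the eigenvectors of index >= q, which
   has codimension q. *)
Lemma eigs_le_hform n (A : 'M[C]_n) (W : {vspace 'cV[C]_n}) (q : 'I_n) (c : R) :
  A \is hermsymmx -> (q < \dim W)%N ->
  (forall x, x \in W -> (x^t* *m A *m x) 0 0 <= c%:C * (x^t* *m x) 0 0) ->
  eigs A 0 q <= c.
Proof.
move=> /unitary_diag_eigs[U U1 AU] ltqW Wc.
(* [B] consists of the first [q] rows of [U^t*], so its kernel is the span of the eigenvectors of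
   index at least [q]. *)
pose B : 'M[C]_(q, n) := \matrix_(i, j) U^t* (widen_ord (ltnW (ltn_ord q)) i) j.
pose V := (W :&: lker (linfun (mulmx B : 'cV_n -> 'cV_q)))%VS.
(* As [q] is 0-based, [W] has dimension at least [q + 1], and [q] equations leave a nonzero
   vector. *)
have V0 : V != 0%VS.
  rewrite -dimv_eq0 -lt0n; have := leq_trans ltqW (dim_cap_lker B W).
  by rewrite -addn1 addnC leq_add2r.
have /memv_capP[xW] := memv_pick V; rewrite memv_ker lfunE /= => /eqP Bx.
have x0 : vpick V != 0 by rewrite vpick0.
move: (vpick V) xW Bx x0 => x xW Bx x0.
(* At [x] the form lies between [eigs A 0 q] and [c] times the positive number [x^t* *m x], which
   cancels. *)
rewrite -lecR -(ler_pM2r (dotc_gt0 x0)) (le_trans _ (Wc _ xW)) //.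
apply: (hform_ge U1 AU) => k; have [lt_kq|le_qk _] := ltnP k q; last exact: eigs_le.
have /colP/(_ (Ordinal lt_kq)) := Bx.
rewrite !mxE => Bxk /eqP[]; rewrite -[RHS]Bxk.
by apply: eq_bigr => j _; rewrite !mxE; congr (Num.conj (U _ _) * _); apply: val_inj.
Qed.

Lemma hermsymmx_compress m n (A : 'M[C]_n) (V : 'M[C]_(n, m)) :
  A \is hermsymmx -> V^t* *m A *m V \is hermsymmx.
Proof.
move=> /is_hermitianmxP; rewrite expr0 scale1r => A_eq.
apply/is_hermitianmxP; rewrite expr0 scale1r !trmx_mul !map_mxM /=.
by rewrite trmxCK -A_eq mulmxA.
Qed.

Lemma hermsymmx_opp n (A : 'M[C]_n) : A \is hermsymmx -> - A \is hermsymmx.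
Proof.
move=> /is_hermitianmxP; rewrite expr0 scale1r => A_eq.
by apply/is_hermitianmxP; rewrite expr0 scale1r linearN /= map_mxN -A_eq.
Qed.

End Hermitian.

(** * Eigenflags, dual subsets and the linear action on Schubert varieties *)

Section Schubert.
Variable R : realType.
Local Notation C := R[i].
Local Notation diagC l := (diag_mx (\row_k (l k)%:C)).

Lemma eigenflag_diag d (X U : 'M[C]_d) (l : 'I_d -> R) :
  (forall k, X *m col k U = (l k)%:C *: col k U) -> X *m U = U *m diagC l.
Proof.
move=> XU; apply/matrixP => i k; have /colP/(_ i) := XU k.
rewrite mul_mx_diag colE mulmxA -!colE !mxE => ->.
by rewrite mulrC.
Qed.

(** Orthonormality puts every spanning column, hence the span, in the kernel of row [j] of
    [U^t*]. *)
Lemma span_cols_coord0 d (U : 'M[C]_d) (k j : 'I_d) (x : 'cV[C]_d) :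
  U \is unitarymx ->
  x \in <<[seq col j U | j : 'I_d <- enum 'I_d & (j <= k)%N]>>%VS ->
  (k < j)%N -> (U^t* *m x) j 0 = 0.
Proof.
move=> /unitarymxP/mulmx1C UU + lt_kj.
have /span_subvP sub : {subset [seq col j U | j : 'I_d <- enum 'I_d & (j <= k)%N]
    <= lker (linfun (mulmx (row j (U^t*)) : 'cV_d -> 'cV_1))}.
  move=> z /mapP[m + ->]; rewrite mem_filter => /andP[le_mk _].
  rewrite memv_ker lfunE /= colE mulmxA -row_mul.
  rewrite UU -colE; apply/eqP/colP => a.
  by rewrite !mxE -val_eqE /= gtn_eqF ?(leq_ltn_trans le_mk).
move=> /(subvP sub); rewrite memv_ker lfunE /= -row_mul => /eqP/colP/(_ 0).
by rewrite !mxE.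
Qed.

Lemma elt_le r d (I : ksubset r d) (p q : 'I_r) :
  (p <= q)%N -> (elt I p <= elt I q)%N.
Proof.
by rewrite leq_eqVlt => /predU1P[/val_inj-> //|/(elt_lt I)/ltnW].
Qed.

Lemma elt_inj r d (I : ksubset r d) : injective (elt I).
Proof. by move=> p q /enum_val_inj/cast_ord_inj. Qed.

(** The [r] distinct values of [f] exhaust [J], and a finite set of ordinals has only one increasing
    enumeration. *)
Lemma elt_unique r d (J : ksubset r d) (f : 'I_r -> 'I_d) :
  (forall p q : 'I_r, (p < q)%N -> (f p < f q)%N) ->
  (forall q, f q \in (J : {set 'I_d})) -> f =1 elt J.
Proof.
move=> f_lt fJ q; pose lt_ord := [rel i j : 'I_d | (i < j)%N].
have lt_trans : transitive lt_ord by move=> j i k; exact: ltn_trans.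
have lt_irr : irreflexive lt_ord by move=> i; exact: ltnn.
have f_sorted : sorted lt_ord [seq f p | p <- enum 'I_r].
  rewrite sorted_map; apply: (@sub_sorted _ (fun j k : 'I_r => (j < k)%N)).
    by move=> i j; exact: f_lt.
  by have := iota_ltn_sorted 0 r; rewrite -val_enum_ord sorted_map.
have J_sorted : sorted lt_ord (enum J).
  rewrite {1}/enum_mem -enumT.
  apply: (subseq_sorted lt_trans (filter_subseq _ _)).
  by have := iota_ltn_sorted 0 d; rewrite -val_enum_ord sorted_map.
have f_enum : [seq f p | p <- enum 'I_r] = enum J.
  apply: (irr_sorted_eq lt_trans lt_irr f_sorted J_sorted).
  have f_uniq := sorted_uniq lt_trans lt_irr f_sorted.
  have [||//] := uniq_min_size f_uniq (s2 := enum J).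
    by move=> _ /mapP[p _ ->]; rewrite mem_enum fJ.
  by rewrite size_map size_enum_ord -cardE card_kset.
rewrite /elt /enum_val -f_enum (nth_map q) ?size_enum_ord //=.
by rewrite nth_ord_enum.
Qed.

(** Reversing both the index and the value gives an increasing map into [dual I], so [elt_unique]
    applies. *)
Lemma elt_dual r d (I : ksubset r d) (q : 'I_r) :
  elt (dual I) q = rev_ord (elt I (rev_ord q)).
Proof.
apply/esym/(@elt_unique _ _ (dual I) (fun q => rev_ord (elt I (rev_ord q)))).
  move=> i j lt_ij; have lt_rev : (rev_ord j < rev_ord i)%N.
    by rewrite /= ltn_sub2l // (leq_ltn_trans _ (ltn_ord j)).
  have lt_elt := elt_lt I lt_rev.
  by rewrite /= ltn_sub2l // (leq_ltn_trans lt_elt (ltn_ord _)).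
by move=> p; rewrite /= imset_f // enum_valP.
Qed.

Lemma isom_unitary r d (L : grass R r d) : (isom L)^t* *m isom L = 1%:M.
Proof. by have /andP[/eqP] := xchooseP (isometry_exists L). Qed.

Lemma isom_img r d (L : grass R r d) : mximg (isom L) fullv = L.
Proof. by have /andP[_ /eqP] := xchooseP (isometry_exists L). Qed.

(** [M] preserves dimensions and carries the intersection of [L] with a flag member into that of
    their images. *)
Lemma schubert_act r d (I : ksubset r d) (E : flag R d) (M : gl R d)
    (L : grass R r d) :
  schubert I E L -> schubert I (flag_act M E) (gr_act M L).
Proof.
move=> EL q; apply: (leq_trans (EL q)).
by rewrite -(dim_gl M) dimvS // subv_cap !limgS ?capvSl ?capvSr.
Qed.

Lemma mximgK d (M : gl R d) U : mximg (gl_inv M) (mximg M U) = U.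
Proof.
apply/eqP; rewrite eq_sym eqEdim !dim_gl leqnn andbT; apply/subvP => x xU.
have -> : x = linfun (mulmx (gl_inv M)) (linfun (mulmx M) x).
  by rewrite !lfunE /= mulmxA mulVmx ?mul1mx ?gl_unit.
by rewrite !memv_img.
Qed.

Lemma schubert_actV r d (I : ksubset r d) (E : flag R d) (M : gl R d)
    (L : grass R r d) :
  schubert I (flag_act M E) L -> schubert I E (gr_act (gl_inv M) L).
Proof.
by move=> /(schubert_act (gl_inv M)) EL q; have := EL q; rewrite /= mximgK.
Qed.

Lemma gr_actK r d (M : gl R d) (L : grass R r d) :
  gr_act (gl_inv M) (gr_act M L) = L.
Proof.
case: L => L dimL; rewrite /gr_act /=; move: (etrans _ _).
by rewrite mximgK => dimL'; congr Grass; apply: eq_irrelevance.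
Qed.

(** * Increasing eigenflags: the upper bounds and a point attaining them *)

Lemma eigs_compress_le r d (I : ksubset r d) (X : 'M[C]_d) (F : flag R d)
    (L : grass R r d) (q : 'I_r) :
  X \is hermsymmx -> increasing_eigenflag X F -> schubert I F L ->
  eigs (compress X L) 0 q <= eigs X 0 (elt I q).
Proof.
move=> hX [l l_le [U U1 [/eigenflag_diag XU FU]]] FL.
rewrite (eigs_unitary_diag l_le U1 XU).
set V := isom L; pose f := linfun (mulmx V : 'cV_r -> 'cV_d).
(* Courant-Fischer needs a test space in [C^r]: the preimage of [L :&: F (elt I q)] under the
   isometry, of the same dimension because the intersection lies in the image [L]. *)
have fW : (f @: (f @^-1: (L :&: F (elt I q))))%VS = (L :&: F (elt I q))%VS.
  by rewrite lpreimK // -[limg f]/(mximg V fullv) isom_img capvSl.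
apply: (eigs_le_hform (W := f @^-1: (L :&: F (elt I q)))).
- exact: hermsymmx_compress.
- by rewrite -(dim_mximg _ (isom_unitary L)) [mximg _ _]fW FL.
move=> x; rewrite -memv_preim lfunE /= => /memv_capP[_].
rewrite FU => VxF.
have -> : (x^t* *m compress X L *m x) = (V *m x)^t* *m X *m (V *m x).
  by rewrite trmx_mul map_mxM /= /compress !mulmxA.
have -> : (x^t* *m x) = (V *m x)^t* *m (V *m x).
  by rewrite trmx_mul map_mxM /= mulmxA -(mulmxA (x^t*)) isom_unitary mulmx1.
(* An eigenvalue above [l (elt I q)] has index beyond [elt I q], where vectors of that flag member
   have zero coordinate. *)
apply: (hform_le U1 XU) => k; apply: contra_neqT; rewrite -ltNge => lt_l.
apply: (span_cols_coord0 U1 VxF); rewrite ltnNge.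
by apply: contraL lt_l => /l_le; rewrite leNgt.
Qed.

(* The extremal point is the span of the eigenvectors with indices in I. *)
Lemma schubert_eigs_attained r d (I : ksubset r d) (X : 'M[C]_d) (F : flag R d) :
  increasing_eigenflag X F ->
  exists2 L : grass R r d, schubert I F L &
    eigs (compress X L) = \row_q eigs X 0 (elt I q).
Proof.
move=> [l l_le [U U1 [/eigenflag_diag XU FU]]].
have UU : U^t* *m U = 1%:M by apply: mulmx1C; apply/unitarymxP.
pose V : 'M[C]_(d, r) := colsub (elt I) U.
have VV : V^t* *m V = 1%:M.
  apply/matrixP => i j; have /matrixP/(_ (elt I i) (elt I j)) := UU.
  rewrite !mxE (inj_eq (@elt_inj _ _ I)) => <-.
  by apply: eq_bigr => k _; rewrite !mxE.
have XV : X *m V = V *m diagC (fun q => l (elt I q)).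
  apply/matrixP => i q; have /matrixP/(_ i (elt I q)) := XU.
  rewrite !mul_mx_diag !mxE => <-.
  by apply: eq_bigr => k _; rewrite !mxE.
have dimV : \dim (mximg V fullv) = r.
  by rewrite (dim_mximg _ VV) dimvf /dim /= muln1.
exists (Grass dimV); last first.
  (* The explicit [V] replaces the chosen isometry; the compression then becomes diagonal with
     increasing entries. *)
  rewrite -(@eigs_compress _ _ _ _ _ V) /isometry_onto ?VV ?eqxx //.
  apply/rowP => q; rewrite [RHS]mxE (eigs_unitary_diag l_le U1 XU).
  apply: (@eigs_unitary_diag _ _ _ 1%:M (fun q => l (elt I q))) => [j k /(elt_le I)/l_le // | |].
    by apply/unitarymxP; rewrite trmx1 map_mx1 mulmx1.
  by rewrite mulmx1 mul1mx -mulmxA XV mulmxA VV mul1mx.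
(* [B] extracts the coordinates of index greater than [q]. Its kernel thus has dimension at least
   [q.+1], and [V] maps it to combinations of the eigenvectors indexed by [elt I j] with [j <= q],
   all in [F (elt I q)]. *)
move=> q; pose B : 'M[C]_(r - q.+1, r) := \matrix_(i, j) (q.+1 + i == j)%N%:R.
pose K := lker (linfun (mulmx B : 'cV_r -> 'cV_(r - q.+1))).
have dimK : (q.+1 <= \dim K)%N.
  have := dim_cap_lker B fullv; rewrite capfv dimvf /dim /= muln1.
  by rewrite addnC -leq_subLR subKn.
apply: (leq_trans dimK); rewrite -(dim_mximg K VV) dimvS // subv_cap.
rewrite limgS ?subvf //=; apply/subvP => _ /memv_imgP[y + ->].
rewrite memv_ker !lfunE /= => /eqP By.
have -> : V *m y = \sum_j y j 0 *: col (elt I j) U.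
  apply/colP => i; rewrite mxE summxE; apply: eq_bigr => j _.
  by rewrite !mxE mulrC.
rewrite FU; apply: memv_suml => j _; have [le_jq|lt_qj] := leqP j q.
  apply/memvZ/memv_span/mapP; exists (elt I j) => //.
  by rewrite mem_filter mem_enum elt_le.
suff -> : y j 0 = 0 by rewrite scale0r mem0v.
have lt_j : (j - q.+1 < r - q.+1)%N by rewrite ltn_sub2r // (leq_ltn_trans lt_qj).
have /colP/(_ (Ordinal lt_j)) := By; rewrite !mxE (bigD1 j) //=.
rewrite mxE /= subnKC // eqxx mul1r big1 ?addr0 // => i ij.
by rewrite mxE /= subnKC // val_eqE eq_sym (negPf ij) mul0r.
Qed.

(** * Decreasing eigenflags, by negation *)

Lemma increasing_eigenflag_opp d (X : 'M[C]_d) (F : flag R d) :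
  decreasing_eigenflag X F -> increasing_eigenflag (- X) F.
Proof.
move=> [l l_le [U U1 [XU FU]]].
exists (fun k => - l k) => [j k /l_le|]; first by rewrite lerN2.
exists U => //; split=> // k.
by rewrite mulNmx XU rmorphN scaleNr.
Qed.

Lemma eigs_compress_opp r d (X : 'M[C]_d) (L : grass R r d) (q : 'I_r) :
  X \is hermsymmx ->
  eigs (compress (- X) L) 0 q = - eigs (compress X L) 0 (rev_ord q).
Proof.
move=> hX; rewrite {1}/compress mulmxN mulNmx.
exact: (eigs_opp (hermsymmx_compress (isom L) hX)).
Qed.

Lemma eigs_compress_ge r d (I : ksubset r d) (X : 'M[C]_d) (F : flag R d)
    (L : grass R r d) (q : 'I_r) :
  X \is hermsymmx -> decreasing_eigenflag X F -> schubert (dual I) F L ->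
  eigs X 0 (elt I q) <= eigs (compress X L) 0 q.
Proof.
move=> hX /increasing_eigenflag_opp incF FL.
(* The upper bound is used at the reversed index; the reversals from [eigs_opp] and [elt_dual] then
   cancel. *)
have := eigs_compress_le (rev_ord q) (hermsymmx_opp hX) incF FL.
rewrite [leLHS](eigs_compress_opp L _ hX) [leRHS](eigs_opp hX).
by rewrite elt_dual !rev_ordK lerN2.
Qed.

(** The point found for [- X] and [dual I] works: the reversal caused by negation matches the one in
    [elt_dual]. *)
Lemma schubert_dual_eigs_attained r d (I : ksubset r d) (X : 'M[C]_d)
    (F : flag R d) :
  X \is hermsymmx -> decreasing_eigenflag X F ->
  exists2 L : grass R r d, schubert (dual I) F L &
    eigs (compress X L) = \row_q eigs X 0 (elt I q).
Proof.
move=> hX /increasing_eigenflag_opp/(schubert_eigs_attained (dual I))[L FL Leq].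
exists L => //; apply/rowP => q; rewrite [RHS]mxE; apply: oppr_inj.
rewrite -[in LHS](rev_ordK q) -(eigs_compress_opp L _ hX) Leq [LHS]mxE.
by rewrite [LHS](eigs_opp hX) elt_dual !rev_ordK.
Qed.

End Schubert.

(** * Extrema of monotone functions over the two Schubert varieties *)

Local Open Scope ring_scope.
Local Open Scope complex_scope.
Local Open Scope classical_set_scope.

Theorem theorem11 (R : realType) (r d : nat) (hr : (1 <= r <= d)%N)
    (I : ksubset r d) (X : 'M[R[i]]_d) (hX : X \is hermsymmx) (M : gl R d)
    (Fup : flag R d) (hup : increasing_eigenflag X Fup)
    (Fdown : flag R d) (hdown : decreasing_eigenflag X Fdown) :
  let OmegaUp : set (grass R r d) := schubert I (flag_act M Fup) in
  let OmegaDown : set (grass R r d) := schubert (dual I) (flag_act M Fdown) in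
  let lambdaI : 'rV[R]_r := \row_q eigs X 0 (elt I q) in
  [/\ forall L, OmegaUp L -> forall q : 'I_r,
        eigs (compress X (gr_act (gl_inv M) L)) 0 q <= eigs X 0 (elt I q),
      forall L, OmegaDown L -> forall q : 'I_r,
        eigs (compress X (gr_act (gl_inv M) L)) 0 q >= eigs X 0 (elt I q)
    & forall phi : 'rV[R]_r -> R,
      (coord_nondecreasing phi ->
         is_max [set Theta X phi (gr_act (gl_inv M) L) | L in OmegaUp]
           (phi lambdaI) /\
         is_min [set Theta X phi (gr_act (gl_inv M) L) | L in OmegaDown]
           (phi lambdaI)) /\
      (coord_nonincreasing phi ->
         is_min [set Theta X phi (gr_act (gl_inv M) L) | L in OmegaUp]
           (phi lambdaI) /\
         is_max [set Theta X phi (gr_act (gl_inv M) L) | L in OmegaDown]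
           (phi lambdaI))].
Proof.
move=> OmegaUp OmegaDown lambdaI.
have up_le L : OmegaUp L -> forall q : 'I_r,
    eigs (compress X (gr_act (gl_inv M) L)) 0 q <= lambdaI 0 q.
  move=> /schubert_actV FL q; rewrite [leRHS]mxE.
  exact: eigs_compress_le hX hup FL.
have down_ge L : OmegaDown L -> forall q : 'I_r,
    lambdaI 0 q <= eigs (compress X (gr_act (gl_inv M) L)) 0 q.
  move=> /schubert_actV FL q; rewrite [leLHS]mxE.
  exact: eigs_compress_ge hX hdown FL.
(* One point realises all the eigenvalue equalities at once, so the value is attained for every
   [phi], monotone or not. *)
have up_att phi :
    [set Theta X phi (gr_act (gl_inv M) L) | L in OmegaUp] (phi lambdaI).
  have [L FL eqL] := schubert_eigs_attained I hup.
  exists (gr_act M L); first exact: schubert_act.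
  by rewrite gr_actK /Theta eqL.
have down_att phi :
    [set Theta X phi (gr_act (gl_inv M) L) | L in OmegaDown] (phi lambdaI).
  have [L FL eqL] := schubert_dual_eigs_attained I hX hdown.
  exists (gr_act M L); first exact: schubert_act.
  by rewrite gr_actK /Theta eqL.
split=> [L /up_le le_L q|L /down_ge ge_L q|phi].
- by have := le_L q; rewrite [leRHS]mxE.
- by have := ge_L q; rewrite [leLHS]mxE.
(* Attainment is settled; monotonicity reduces each bound on [phi] to the coordinatewise eigenvalue
   bounds. *)
split=> phi_mono; split; split=> // _ [L OL <-]; apply: phi_mono.
- exact: up_le.
- exact: down_ge.
- exact: up_le.
- exact: down_ge.
Qed.
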